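(* Let $0<\alpha<\frac14$, $\theta=\operatorname{arcosh}\big(\tfrac12\alpha^{-1/2}\big)$, $F_0(x)=\frac12\big(1-\tanh(\theta)\tanh(\tfrac{x\theta}{2})\big)$ and $F_0^*(x)=1-F_0(x)=\frac12\big(1+\tanh(\theta)\tanh(\tfrac{x\theta}{2})\big)$ for real $x$. Then (1) $F_0$ is strictly decreasing and convex on $(0,+\infty)$; (2) $F_0^*$ is strictly increasing and concave on $(0,+\infty)$, and log-concave on $[-1,+\infty)$.
   Context: A function $g$ is log-concave on an interval $I$ if $g(x)\ge0$ on $I$ and $x\mapsto\log g(x)$ is concave on $I$. *)

(* Defs.v *)
From Stdlib Require Import Reals Lra.
From Coquelicot Require Import Rbar.
Open Scope R_scope.

Definition strictly_increasing_on (I : R -> Prop) (f : R -> R) : Prop :=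
  forall x y : R, I x -> I y -> x < y -> f x < f y.

Definition strictly_decreasing_on (I : R -> Prop) (f : R -> R) : Prop :=
  forall x y : R, I x -> I y -> x < y -> f y < f x.

(* Below, [I] is meant to be an interval, so that the convex combinations
   stay in [I]. *)
Definition convex_on (I : R -> Prop) (f : R -> R) : Prop :=
  forall x y t : R, I x -> I y -> 0 <= t <= 1 ->
    f (t * x + (1 - t) * y) <= t * f x + (1 - t) * f y.

Definition concave_on (I : R -> Prop) (f : R -> R) : Prop :=
  forall x y t : R, I x -> I y -> 0 <= t <= 1 ->
    t * f x + (1 - t) * f y <= f (t * x + (1 - t) * y).

(* Weights are restricted to 0 < t < 1, so that no product 0 * oo occurs; the
   sum is well defined as long as [f] does not take the value [p_infty]. *)
Definition Rbar_concave_on (I : R -> Prop) (f : R -> Rbar) : Prop :=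
  forall x y t : R, I x -> I y -> 0 < t < 1 ->
    Rbar_le (Rbar_plus (Rbar_mult t (f x)) (Rbar_mult (1 - t) (f y)))
            (f (t * x + (1 - t) * y)).

(* The logarithm on [0, +oo) with log 0 = -oo, whereas [ln 0 = 0]. *)
Definition Rbar_ln (x : R) : Rbar :=
  if Rlt_dec 0 x then Finite (ln x) else m_infty.

Definition log_concave_on (I : R -> Prop) (g : R -> R) : Prop :=
  (forall x : R, I x -> 0 <= g x) /\
  Rbar_concave_on I (fun x => Rbar_ln (g x)).

Definition arcosh (x : R) : R := ln (x + sqrt (x ^ 2 - 1)).

Lemma arcosh_ge0 (x : R) : 1 <= x -> 0 <= arcosh x.
Proof.
intros Hx; unfold arcosh; rewrite <- ln_1.
pose proof (sqrt_pos (x ^ 2 - 1)).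
destruct (Rle_lt_or_eq_dec 1 (x + sqrt (x ^ 2 - 1))) as [H1|H1]; [lra| |].
- left; apply ln_increasing; lra.
- rewrite <- H1; lra.
Qed.

Lemma cosh_arcosh (x : R) : 1 <= x -> cosh (arcosh x) = x.
Proof.
intros Hx; unfold arcosh, cosh.
pose proof (sqrt_pos (x ^ 2 - 1)) as Hs.
assert (Hq : sqrt (x ^ 2 - 1) * sqrt (x ^ 2 - 1) = x ^ 2 - 1).
{ apply sqrt_sqrt; simpl; nra. }
rewrite exp_Ropp, exp_ln by lra.
apply Rmult_eq_reg_r with (2 * (x + sqrt (x ^ 2 - 1))); [|lra].
field_simplify; [|lra].
nra.
Qed.

Definition theta (alpha : R) : R := arcosh (1 / 2 * Rpower alpha (- (1 / 2))).

Definition F0 (alpha x : R) : R :=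
  1 / 2 * (1 - tanh (theta alpha) * tanh (x * theta alpha / 2)).

Definition F0_star (alpha x : R) : R := 1 - F0 alpha x.

Lemma F0_starE (alpha x : R) :
  F0_star alpha x =
  1 / 2 * (1 + tanh (theta alpha) * tanh (x * theta alpha / 2)).
Proof. unfold F0_star, F0; field. Qed.

(* Main.v *)
(** Put [u = x * theta / 2].  By the addition formula,
    [F0_star x = cosh (u + theta) / (2 * cosh theta * cosh u)], so the
    logarithmic derivative of [F0_star] is
    [theta * sinh theta / (cosh (2 * u + theta) + cosh theta)].  It decreases in
    [x] exactly as long as [2 * u + theta = theta * (x + 1)] is nonnegative,
    i.e. for [-1 <= x].  The other claims reduce to [tanh] being increasing with
    derivative [/ cosh ^ 2]. *)

Require Import Defs.
From Stdlib Require Import Reals Lra.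
From Coquelicot Require Import Coquelicot.
Open Scope R_scope.

Lemma cosh_pos (x : R) : 0 < cosh x.
Proof.
unfold cosh; pose proof (exp_pos x); pose proof (exp_pos (- x)); lra.
Qed.

Lemma cosh_le (x y : R) : 0 <= x <= y -> cosh x <= cosh y.
Proof.
intros [Hx [Hxy|<-]]; [|lra].
destruct (MVT_cor2 cosh sinh x y Hxy) as (c & Hc & Hcxy).
- intros; apply derivable_pt_lim_cosh.
- assert (0 < sinh c) by (rewrite <- sinh_0; apply sinh_lt; lra); nra.
Qed.

Lemma sinh_pos (x : R) : 0 < x -> 0 < sinh x.
Proof. intros Hx; rewrite <- sinh_0; now apply sinh_lt. Qed.

(** After clearing the denominator, the bounds say that [cosh x + sinh x = exp x] and
    [cosh x - sinh x = exp (- x)] are positive. *)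
Lemma tanh_bounds (x : R) : -1 < tanh x < 1.
Proof.
pose proof (cosh_pos x) as Hc; unfold tanh; split.
- apply Rmult_lt_reg_r with (cosh x); [easy|].
  unfold Rdiv; rewrite Rmult_assoc, Rinv_l by lra.
  unfold sinh, cosh; pose proof (exp_pos x); lra.
- apply Rmult_lt_reg_r with (cosh x); [easy|].
  unfold Rdiv; rewrite Rmult_assoc, Rinv_l by lra.
  unfold sinh, cosh; pose proof (exp_pos (- x)); lra.
Qed.

Lemma cosh2_sub_sinh2 (x : R) : cosh x * cosh x - sinh x * sinh x = 1.
Proof.
unfold cosh, sinh; rewrite exp_Ropp; field.
apply Rgt_not_eq, exp_pos.
Qed.

Lemma derivable_pt_lim_tanh (x : R) :
  derivable_pt_lim tanh x (/ (cosh x * cosh x)).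
Proof.
pose proof (cosh_pos x).
replace (/ (cosh x * cosh x))
  with ((cosh x * cosh x - sinh x * sinh x) / Rsqr (cosh x))
  by (rewrite cosh2_sub_sinh2; unfold Rsqr; field; lra).
apply (derivable_pt_lim_div sinh cosh);
  [apply derivable_pt_lim_sinh | apply derivable_pt_lim_cosh | lra].
Qed.

Lemma tanh_lt (x y : R) : x < y -> tanh x < tanh y.
Proof.
intros Hxy.
destruct (MVT_cor2 tanh (fun c => / (cosh c * cosh c)) x y Hxy)
  as (c & Hc & _).
- intros; apply derivable_pt_lim_tanh.
- pose proof (cosh_pos c).
  assert (0 < / (cosh c * cosh c)) by (apply Rinv_0_lt_compat; nra); nra.
Qed.

Lemma tanh_pos (x : R) : 0 < x -> 0 < tanh x.
Proof.
intros Hx; apply Rdiv_lt_0_compat; [now apply sinh_pos|apply cosh_pos].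
Qed.

(** The mean value theorem on either side of the intermediate point [z] gives slopes [df c] and
    [df d] with [c < z < d], so [df d <= df c]. The first hypothesis makes [I] an interval, which
    keeps [c] and [d] inside it. *)
Lemma concave_of_decreasing_derivative (I : R -> Prop) (f df : R -> R) :
  (forall x y z, I x -> I y -> x <= z <= y -> I z) ->
  (forall x, I x -> derivable_pt_lim f x (df x)) ->
  (forall x y, I x -> I y -> x <= y -> df y <= df x) ->
  concave_on I f.
Proof.
intros HI Hd Hdec.
assert (Hlt : forall x y t, I x -> I y -> 0 < t < 1 -> x < y ->
  t * f x + (1 - t) * f y <= f (t * x + (1 - t) * y)).
{ intros x y t Hx Hy Ht Hxy.
  set (z := t * x + (1 - t) * y).
  assert (Hxz : z - x = (1 - t) * (y - x)) by (unfold z; ring).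
  assert (Hzy : y - z = t * (y - x)) by (unfold z; ring).
  assert (x < z) by nra.
  assert (z < y) by nra.
  destruct (MVT_cor2 f df x z) as (c & Hc & Hxcz); [easy| |].
  { intros c Hc; apply Hd, (HI x y); [easy..|lra]. }
  destruct (MVT_cor2 f df z y) as (d & He & Hzdy); [easy| |].
  { intros d He; apply Hd, (HI x y); [easy..|lra]. }
  assert (Hcd : df d <= df c).
  { apply Hdec; [apply (HI x y)|apply (HI x y)|]; (easy || lra). }
  rewrite Hxz in Hc; rewrite Hzy in He.
  (* The height of the graph above the chord at [z] is a nonnegative multiple of the drop in
     slope. *)
  assert (Hgap : f z - (t * f x + (1 - t) * f y)
                 = t * (1 - t) * (y - x) * (df c - df d)).
  { transitivity (t * (f z - f x) - (1 - t) * (f y - f z)); [ring|].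
    rewrite Hc, He; ring. }
  assert (0 <= t * (1 - t) * (y - x) * (df c - df d)).
  { repeat apply Rmult_le_pos; lra. }
  lra. }
intros x y t Hx Hy Ht.
destruct (Req_dec t 0) as [->|Ht0].
{ replace (0 * x + (1 - 0) * y) with y by ring; lra. }
destruct (Req_dec t 1) as [->|Ht1].
{ replace (1 * x + (1 - 1) * y) with x by ring; lra. }
destruct (Rtotal_order x y) as [Hxy|[<-|Hyx]].
- apply Hlt; (easy || lra).
- replace (t * x + (1 - t) * x) with x by ring; lra.
- pose proof (Hlt y x (1 - t) Hy Hx ltac:(lra) Hyx) as H.
  replace (1 - (1 - t)) with t in H by ring.
  rewrite (Rplus_comm (t * x)); lra.
Qed.

(** Positivity keeps [Rbar_ln (g x)] finite, so the extended inequality computes to the real one. *)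
Lemma log_concave_of_concave_ln (I : R -> Prop) (g : R -> R) :
  (forall x, 0 < g x) -> concave_on I (fun x => ln (g x)) ->
  log_concave_on I g.
Proof.
intros Hg Hc; split; [intros x _; left; apply Hg|].
intros x y t Hx Hy Ht; unfold Rbar_ln.
destruct (Rlt_dec 0 (g x)) as [_|H]; [|now destruct H].
destruct (Rlt_dec 0 (g y)) as [_|H]; [|now destruct H].
destruct (Rlt_dec 0 (g (t * x + (1 - t) * y))) as [_|H]; [|now destruct H].
apply Hc; (easy || lra).
Qed.

Lemma theta_pos (alpha : R) : 0 < alpha < 1 / 4 -> 0 < theta alpha.
Proof.
intros Ha.
assert (H1 : 1 < 1 / 2 * Rpower alpha (- (1 / 2))).
(* This is [alpha < 1 / 4] in logarithms; multiplying by [- (1 / 2)] and exponentiating gives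
   [2 < Rpower alpha (- (1 / 2))]. *)
{ assert (Hln : ln alpha < - (2 * ln 2)).
  { replace (2 * ln 2) with (ln 4).
    - rewrite <- ln_Rinv by lra; apply ln_increasing; lra.
    - replace 4 with (2 * 2) by ring; rewrite ln_mult by lra; ring. }
  assert (H2 : exp (ln 2) < Rpower alpha (- (1 / 2)))
    by (unfold Rpower; apply exp_increasing; lra).
  rewrite exp_ln in H2 by lra; lra. }
unfold theta.
destruct (arcosh_ge0 (1 / 2 * Rpower alpha (- (1 / 2))) ltac:(lra))
  as [H|H]; [easy|].
(* A zero [theta] would make the argument of [arcosh] equal to [cosh 0 = 1], against [H1]. *)
pose proof (cosh_arcosh (1 / 2 * Rpower alpha (- (1 / 2))) ltac:(lra)) as Hc.
rewrite <- H, cosh_0 in Hc; lra.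
Qed.

Lemma F0_star_pos (alpha x : R) : 0 < F0_star alpha x.
Proof.
rewrite F0_starE.
pose proof (tanh_bounds (theta alpha)).
pose proof (tanh_bounds (x * theta alpha / 2)).
nra.
Qed.

Lemma derivable_pt_lim_F0_star (alpha x : R) :
  derivable_pt_lim (F0_star alpha) x
    (theta alpha * tanh (theta alpha) / 4
     * / (cosh (x * theta alpha / 2) * cosh (x * theta alpha / 2))).
Proof.
apply is_derive_Reals.
apply is_derive_ext
  with (fun x => 1 / 2 * (1 + tanh (theta alpha) * tanh (x * theta alpha / 2))).
{ intros y; now rewrite F0_starE. }
pose proof (proj2 (is_derive_Reals _ _ _)
  (derivable_pt_lim_tanh (x * theta alpha / 2))) as Ht.
auto_derive.
- now exists (/ (cosh (x * theta alpha / 2) * cosh (x * theta alpha / 2))).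
(* [auto_derive] leaves an eta-expanded [tanh] and an unfolded quotient; both are folded back so
   that [Ht] applies. *)
- change (Derive (fun y => tanh y) (x * theta alpha * / 2))
    with (Derive tanh (x * theta alpha / 2)).
  rewrite (is_derive_unique tanh _ _ Ht).
  pose proof (cosh_pos (x * theta alpha / 2)); field; lra.
Qed.

Lemma F0_star_log_derivative (alpha x : R) :
  theta alpha * tanh (theta alpha) / 4
    * / (cosh (x * theta alpha / 2) * cosh (x * theta alpha / 2))
    / F0_star alpha x
  = theta alpha * sinh (theta alpha)
    / (cosh (theta alpha * (x + 1)) + cosh (theta alpha)).
Proof.
pose proof (F0_star_pos alpha x) as HF; revert HF; rewrite F0_starE.
set (th := theta alpha); set (u := x * th / 2); intros HF.
pose proof (cosh_pos th) as Hth; pose proof (cosh_pos u) as Hu.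
pose proof (cosh_pos (th * (x + 1))) as Hs.
(* Sum-to-product formula for [2 * u + th] and [th], with [cosh (u + th)] expanded. Its left side is
   positive, so the last factor on the right does not vanish. *)
assert (Hsum : cosh (th * (x + 1)) + cosh th
               = 2 * cosh u * (cosh th * cosh u + sinh th * sinh u)).
{ replace (th * (x + 1)) with (u + u + th) by (unfold u; field).
  unfold cosh, sinh; rewrite !exp_Ropp, !exp_plus; field.
  split; apply Rgt_not_eq, exp_pos. }
rewrite Hsum in *; unfold tanh in *.
field; repeat split; nra.
Qed.

Theorem theorem3p3 (alpha : R) (halpha : 0 < alpha < 1 / 4) :
  (strictly_decreasing_on (fun x : R => 0 < x) (F0 alpha) /\
   convex_on (fun x : R => 0 < x) (F0 alpha)) /\
  (strictly_increasing_on (fun x : R => 0 < x) (F0_star alpha) /\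
   concave_on (fun x : R => 0 < x) (F0_star alpha) /\
   log_concave_on (fun x : R => -1 <= x) (F0_star alpha)).
Proof.
pose proof (theta_pos alpha halpha) as Hth.
pose proof (tanh_pos _ Hth) as HT.
assert (Hinc : strictly_increasing_on (fun x => 0 < x) (F0_star alpha)).
{ intros x y _ _ Hxy; rewrite !F0_starE.
  assert (tanh (x * theta alpha / 2) < tanh (y * theta alpha / 2))
    by (apply tanh_lt; nra).
  nra. }
assert (Hconc : concave_on (fun x => 0 < x) (F0_star alpha)).
{ eapply concave_of_decreasing_derivative.
  - intros; lra.
  - intros; apply derivable_pt_lim_F0_star.
  - intros x y Hx Hy Hxy; cbv beta in *.
    (* The constant factor is positive, and [cosh] grows on the nonnegative axis, so its inverse
       square decreases. *)
    apply Rmult_le_compat_l; [nra|].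
    pose proof (cosh_pos (x * theta alpha / 2)).
    assert (cosh (x * theta alpha / 2) <= cosh (y * theta alpha / 2))
      by (apply cosh_le; nra).
    apply Rinv_le_contravar; nra. }
split; [split|split; [easy|split; [easy|]]].
(* Both claims on [F0] follow from those on [F0_star] by the reflection [v -> 1 - v]. *)
- intros x y Hx Hy Hxy; pose proof (Hinc x y Hx Hy Hxy).
  unfold F0_star in *; lra.
- intros x y t Hx Hy Ht; pose proof (Hconc x y t Hx Hy Ht).
  unfold F0_star in *; lra.
- apply log_concave_of_concave_ln; [apply F0_star_pos|].
  apply concave_of_decreasing_derivative with
    (fun x => theta alpha * sinh (theta alpha)
              / (cosh (theta alpha * (x + 1)) + cosh (theta alpha))).
  + intros; lra.
  (* The closed form is turned back into derivative over value, then reordered to match the chain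
     rule for [ln]. *)
  + intros x _; rewrite <- F0_star_log_derivative.
    unfold Rdiv at 1; rewrite Rmult_comm.
    apply (derivable_pt_lim_comp (F0_star alpha) ln).
    * apply derivable_pt_lim_F0_star.
    * apply derivable_pt_lim_ln, F0_star_pos.
  + intros x y Hx Hy Hxy; cbv beta in *.
    pose proof (sinh_pos _ Hth).
    pose proof (cosh_pos (theta alpha)).
    pose proof (cosh_pos (theta alpha * (x + 1))).
    (* Here [-1 <= x] enters: it makes [theta alpha * (x + 1)] nonnegative, where [cosh] is
       increasing. *)
    assert (cosh (theta alpha * (x + 1)) <= cosh (theta alpha * (y + 1)))
      by (apply cosh_le; nra).
    apply Rmult_le_compat_l; [nra|].
    apply Rinv_le_contravar; lra.
Qed.
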